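(* Let $0\le k\le m$, let $\Omega\subset\mathbb{R}^m$ be open and let $u\in C^\infty(\Omega)$. Let $M=\{(x,f(x)):x\in\Omega\}$ be the graph of $f=(\nabla u)I_{k,m}$ in $C_k^m=\mathbb{R}^m\oplus i\mathbb{R}^m$, and suppose that $\det(I+i\,\mathrm{Hess}(u)I_{k,m})\neq0$ everywhere on $\Omega$. Then $M$, with a suitable choice of orientation, is indefinite special Lagrangian in $C_k^m$ if and only if $$\mathrm{Im}\{\det(I+i\,\mathrm{Hess}(u)I_{k,m})\}=0\quad\text{on }\Omega,$$ or equivalently $$\mathrm{Im}\{\det(I_{k,m}+i\,\mathrm{Hess}(u))\}=0\quad\text{on }\Omega.$$
   Context: $I$ is the $m\times m$ identity matrix, $I_{k,m}=\mathrm{diag}(\varepsilon_1,\dots,\varepsilon_m)$ with $\varepsilon_j=-1$ for $j\le k$ and $\varepsilon_j=1$ for $j\ge k+1$; $\nabla u=(u_{x_1},\dots,u_{x_m})$ is a row vector and $\mathrm{Hess}(u)=(u_{x_ix_j})$. $C_k^m$ denotes $\mathbb{C}^m=\mathbb{R}^{2m}$ with coordinates $z_j=x_j+iy_j$, metric $g_{(2k,2m)}=\sum_{j}\varepsilon_j(dx_j^2+dy_j^2)$ and symplectic form $\omega_{(k,m)}=\sum_{j}\varepsilon_j\,dx_j\wedge dy_j$; the point $(x,f(x))$ is $x+if(x)$. A real $m$-dimensional submanifold $M$ is Lagrangian if $\omega_{(k,m)}|_M\equiv0$ and the metric induced by $g_{(2k,2m)}$ on $M$ is non-degenerate. An oriented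 Lagrangian submanifold $M$ is indefinite special Lagrangian if $dz_1\wedge\cdots\wedge dz_m(e_1,\dots,e_m)=1$ for every positively oriented Lorentz basis $e_1,\dots,e_m$ of every $T_pM$ (Lorentz basis: $g_{(2k,2m)}(e_j,e_l)=\varepsilon_j\delta_{jl}$). *)

(* Defs.v *)
From HB Require Import structures.
From mathcomp Require Import all_boot all_order all_algebra.
From mathcomp Require Import complex.
From mathcomp Require Import all_classical all_reals all_analysis.

Set Implicit Arguments.
Unset Strict Implicit.
Unset Printing Implicit Defensive.

Import Order.TTheory GRing.Theory Num.Theory.
Import numFieldNormedType.Exports.

Local Open Scope classical_set_scope.
Local Open Scope complex_scope.
Local Open Scope ring_scope.

(* The pair (x, y) stands for the point x + i y of C^m = R^m (+) i R^m. *)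
Notation Cspace R m := ('rV[R]_m * 'rV[R]_m)%type.

Section Smooth.
Context {R : realType} {m : nat} {V : normedModType R}.
Implicit Types (f : 'rV[R]_m -> V) (U : set 'rV[R]_m) (x : 'rV[R]_m).

Definition partial (i : 'I_m) f : 'rV[R]_m -> V :=
  fun x => 'D_(delta_mx 0 i) f x.

(* C^n regularity on an open set U; the values of f outside U play no role. *)
Fixpoint Cn_on (n : nat) U f : Prop :=
  if n is n'.+1 then
    (forall x, U x -> differentiable f x)
    /\ (forall i : 'I_m, Cn_on n' U (partial i f))
  else forall x, U x -> {for x, continuous f}.

Definition smooth_on U f : Prop := forall n, Cn_on n U f.

End Smooth.

Section Hessian.
Context {R : realType} {m : nat}.
Implicit Types (u : 'rV[R]_m -> R) (x : 'rV[R]_m).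

Definition grad u x : 'rV[R]_m := \row_j partial j u x.

Definition hess u x : 'M[R]_m :=
  \matrix_(i, j) partial j (partial i u) x.

End Hessian.

(* 'I_m is indexed from 0: the first k signs are -1, the others are +1. *)
Definition eps (R : realType) (m k : nat) (j : 'I_m) : R :=
  if (j < k)%N then -1 else 1.

Definition Ikm (R : realType) (k m : nat) : 'M[R]_m :=
  diag_mx (\row_j eps R k j).

Definition metric {R : realType} {m : nat} (k : nat) (v w : Cspace R m) : R :=
  \sum_(j < m) eps R k j * (v.1 0 j * w.1 0 j + v.2 0 j * w.2 0 j).

Definition omega {R : realType} {m : nat} (k : nat) (v w : Cspace R m) : R :=
  \sum_(j < m) eps R k j * (v.1 0 j * w.2 0 j - w.1 0 j * v.2 0 j).

Definition dz {R : realType} {m : nat} (j : 'I_m) (v : Cspace R m) : R[i] :=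
  v.1 0 j +i* v.2 0 j.

(* dz_1 /\ ... /\ dz_m evaluated on m vectors, normalized so that it takes the
   value 1 on the standard basis of R^m. *)
Definition dz_wedge {R : realType} {m : nat} (e : m.-tuple (Cspace R m)) : R[i] :=
  \det (\matrix_(l < m, j < m) dz j (tnth e l)).

Section Submanifold.
Context {R : realType} {m : nat}.
Implicit Types (M : set (Cspace R m)) (p : Cspace R m).

(* phi restricts to a smooth immersion of the open set U which is a
   homeomorphism onto a relatively open subset M `&` W of M. *)
Definition local_param M (U : set 'rV[R]_m) (phi : 'rV[R]_m -> Cspace R m) :=
  [/\ open U, smooth_on U phi,
      (forall x, U x -> injective ('d phi x)) &
      exists (W : set (Cspace R m)) (psi : Cspace R m -> 'rV[R]_m),
        [/\ open W, phi @` U = M `&` W,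
            (forall x, U x -> psi (phi x) = x) &
            {within M `&` W, continuous psi}]].

Definition submanifold M : Prop :=
  forall p, M p -> exists U phi, local_param M U phi /\ (phi @` U) p.

(* Velocities at p of curves lying in M. *)
Definition tangent M p : set (Cspace R m) :=
  [set v | exists gamma : R -> Cspace R m,
     [/\ gamma 0 = p, (\forall t \near (0 : R), M (gamma t)) &
         is_derive (0 : R) (1 : R) gamma v]].

Definition tangent_basis M p (e : m.-tuple (Cspace R m)) : Prop :=
  free e /\ tangent M p = [set v | v \in <<e>>%VS].

Definition coord_frame (phi : 'rV[R]_m -> Cspace R m) x :
    m.-tuple (Cspace R m) :=
  [tuple partial j phi x | j < m].

(* O p e tells whether the basis e of T_pM is positively oriented. The first
   condition makes O p an orientation of T_pM (expressed by signs, so that it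
   also covers dimension 0); the second one is continuity in p. *)
Definition orientation M (O : Cspace R m -> m.-tuple (Cspace R m) -> bool) :=
  (forall p e e' (A : 'M[R]_m), M p ->
     tangent_basis M p e -> tangent_basis M p e' ->
     (forall l, tnth e' l = \sum_(j < m) A l j *: tnth e j) ->
     O p e' = ((0 < \det A) == O p e))
  /\ (forall p, M p -> exists U phi (b : bool),
        [/\ local_param M U phi, (phi @` U) p &
            forall x, U x -> O (phi x) (coord_frame phi x) = b]).

Definition lagrangian (k : nat) M : Prop :=
  [/\ submanifold M,
      (forall p, M p -> forall v w, tangent M p v -> tangent M p w ->
         omega k v w = 0) &
      (forall p, M p -> forall v, tangent M p v ->
         (forall w, tangent M p w -> metric k v w = 0) -> v = 0)].

Definition lorentz_basis (k : nat) M p (e : m.-tuple (Cspace R m)) : Prop :=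
  tangent_basis M p e /\
  forall j l, metric k (tnth e j) (tnth e l) = eps R k j *+ (j == l).

Definition special_lagrangian (k : nat) M
    (O : Cspace R m -> m.-tuple (Cspace R m) -> bool) : Prop :=
  [/\ lagrangian k M, orientation M O &
      forall p e, M p -> lorentz_basis k M p e -> O p e -> dz_wedge e = 1].

Definition graph_of (Omega : set 'rV[R]_m) (f : 'rV[R]_m -> 'rV[R]_m) :
    set (Cspace R m) :=
  [set (x, f x) | x in Omega].

End Submanifold.

Definition mxC {R : realType} {m : nat} (A : 'M[R]_m) : 'M[R[i]]_m :=
  map_mx (fun a : R => a%:C) A.

(* Main.v *)
Require Import Defs.
From HB Require Import structures.
From mathcomp Require Import all_boot all_order all_algebra perm.
From mathcomp Require Import complex.
From mathcomp Require Import all_classical all_reals all_analysis.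

(* Put E = I_{k,m}, B = Hess(u) E and Z = I + i B. Since Hess(u) is symmetric,
   B E = E B^T, so the tangent space {(v, v B)} of the graph satisfies
   Z E Z^* = E + B E B^T =: G, which is real: omega vanishes on the graph and the
   induced metric is G, with det G = det E |det Z|^2 <> 0. The identity
   Z E Z^* = G also shows, by Sylvester's law of inertia over the complex numbers,
   that G has k negative squares, hence every tangent space has Lorentz bases.
   These are P [I, B] with P G P^T = E, so (det P)^2 |det Z|^2 = 1, and
   dz_1 /\ ... /\ dz_m takes the value det P det Z on them. Thus it is 1 on a
   Lorentz basis only if det Z is real. Conversely, if det Z is real, it is +-1 on
   all of them, and its sign defines an orientation. *)

Set Implicit Arguments.
Unset Strict Implicit.
Unset Printing Implicit Defensive.

Import Order.TTheory GRing.Theory Num.Theory.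
Import numFieldNormedType.Exports.

Local Open Scope classical_set_scope.
Local Open Scope complex_scope.
Local Open Scope ring_scope.

(** * Symmetric matrices and inertia *)

Lemma tr_diag_mx (R : pzRingType) n (d : 'rV[R]_n) : (diag_mx d)^T = diag_mx d.
Proof. by apply/matrixP => i j; rewrite !mxE eq_sym; case: eqP => // ->. Qed.

(** Polarization: if the form vanished on every sum e_i + e_j, the case i = j would give 4 G_ii = 0
    and then symmetry would give 2 G_ij = 0, so G = 0 in characteristic 0. *)
Lemma exists_nonisotropic (F : numFieldType) n (G : 'M[F]_n) :
  G^T = G -> G != 0 -> exists v : 'rV[F]_n, (v *m G *m v^T) 0 0 != 0.
Proof.
move=> symG nzG.
have [/existsP|] := boolP [exists i, exists j,
    let v : 'rV[F]_n := delta_mx 0 i + delta_mx 0 j in (v *m G *m v^T) 0 0 != 0].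
  by case=> i /existsP[j vn0]; eexists; exact: vn0.
rewrite negb_exists => /forallP allv; case/eqP: nzG.
have E i j : G i i + G i j + (G j i + G j j) = 0.
  move: (allv i); rewrite negb_exists => /forallP/(_ j)/=; rewrite negbK => /eqP.
  by rewrite linearD/= !mulmxDl !mulmxDr !trmx_delta -!rowE -!colE !mxE => <-.
have Gii i : G i i = 0.
  have := E i i; rewrite -!mulr2n => /eqP.
  by rewrite !mulrn_eq0/= => /eqP.
apply/matrixP => i j; rewrite mxE.
have := E i j; rewrite !Gii add0r addr0 -[in G j i]symG mxE -mulr2n => /eqP.
by rewrite mulrn_eq0/= => /eqP.
Qed.

(** Completing the square: a non-isotropic vector is taken as first basis vector, the rest of its
    row and column is cleared, and the induction goes on with the Schur complement. *)
Lemma sym_congr_diag (F : numFieldType) n (G : 'M[F]_n) : G^T = G ->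
  exists (P : 'M[F]_n) (d : 'rV_n), P \in unitmx /\ P *m G *m P^T = diag_mx d.
Proof.
elim: n G => [|n IHn] G symG.
  by exists 1%:M, 0; split; [exact: unitmx1 | apply/matrixP => -[]].
have [->|/(exists_nonisotropic symG)[v vGv]] := eqVneq G 0.
  exists 1%:M, 0; split; first exact: unitmx1.
  by rewrite mulmx0 mul0mx; apply/matrixP => i j; rewrite !mxE mul0rn.
(* [row_ebase v] is an invertible matrix whose first row spans the line of [v], so the corner entry
   of [G1] is the form on that line and cannot vanish. *)
pose Q := row_ebase v.
have [G1 G1def] : exists G1 : 'M[F]_(1 + n), G1 = Q *m G *m Q^T by eexists.
have symG1 : G1^T = G1 by rewrite G1def !trmx_mul trmxK symG mulmxA.
have G100 : G1 0 0 != 0.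
  have [s vE] : exists s, v = s *: row 0 Q.
    pose C : 'rV_n.+1 := col_ebase v *m pid_mx (\rank v); exists (C 0 0).
    rewrite -[v in LHS]mulmx_ebase -/C; apply/rowP => j.
    rewrite mxE big_ord_recl big1 ?addr0 => [|i _]; first by rewrite [RHS]mxE [row 0 Q 0 j]mxE.
    rewrite /C !mxE big_ord1 !mxE/=.
    by rewrite mulr0 mul0r.
  apply: contraNneq vGv => G10; rewrite vE linearZ/= -!scalemxAl -scalemxAr.
  have -> : row 0 Q *m G *m (row 0 Q)^T = (G1 0 0)%:M.
    apply/matrixP => i j; rewrite !ord1 -row_mul [RHS]mxE mulr1n G1def !mxE.
    by apply: eq_bigr => k _; rewrite !mxE.
  by rewrite G10 !mxE ?mulr0n ?mulr1n !mulr0.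
pose a := ulsubmx G1; pose b := ursubmx G1; pose c := drsubmx G1.
have aE : a = (G1 0 0)%:M.
  apply/matrixP => i j; rewrite !ord1 !mxE mulr1n.
  by rewrite (_ : lshift n 0 = 0)//; exact/val_inj.
set g := G1 0 0 in G100 aE.
have G1E : G1 = block_mx a b b^T c.
  by rewrite -[LHS]submxK /b -[in ursubmx _]symG1 trmx_ursub trmxK symG1.
(* Block elimination: congruence by [L] kills [b] and [b^T] and replaces [c] by the Schur complement
   of the corner. *)
pose L : 'M[F]_(1 + n) := block_mx 1%:M 0 (- g^-1 *: b^T) 1%:M.
have unitL : L \in unitmx by rewrite unitmxE /L det_lblock !det1 mulr1 unitr1.
have LG : L *m G1 *m L^T = block_mx a 0 0 (c - g^-1 *: (b^T *m b)).
  rewrite G1E /L tr_block_mx !trmx1 trmx0 linearZ/= trmxK !mulmx_block aE.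
  rewrite !mul1mx !mulmx1 !mul0mx !mulmx0 !addr0.
  rewrite mul_scalar_mx scalerA mulrN mulfV// scaleN1r addNr.
  rewrite mul_mx_scalar scalerA mulrN mulfV// scaleN1r addNr mul0mx add0r.
  by rewrite -scalemxAl scaleNr addrC.
have [P2 [d2 [unitP2 P2E]]] : exists (P : 'M[F]_n) (d : 'rV_n), P \in unitmx /\
    P *m (c - g^-1 *: (b^T *m b)) *m P^T = diag_mx d.
  apply: IHn; rewrite linearB linearZ/= trmx_mul trmxK; congr (_ - _).
  by rewrite /c trmx_drsub symG1.
pose P1 : 'M[F]_(1 + n) := block_mx 1%:M 0 0 P2.
have unitP1 : P1 \in unitmx by rewrite unitmxE det_ublock det1 mul1r -unitmxE.
exists (P1 *m L *m Q), (row_mx g%:M d2); split.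
  by rewrite !unitmx_mul unitP1 unitL row_ebase_unit.
have -> : P1 *m L *m Q *m G *m (P1 *m L *m Q)^T = P1 *m (L *m G1 *m L^T) *m P1^T.
  by rewrite G1def !trmx_mul !mulmxA.
rewrite LG /P1 tr_block_mx !trmx0 !trmx1 !mulmx_block.
rewrite !mul1mx !mulmx1 !mul0mx !mulmx0 !addr0 !add0r P2E aE.
apply: etrans (esym (@diag_mx_row _ n 1 _ _)); congr block_mx; rewrite ?mul0mx//.
by apply/matrixP => i j; rewrite !ord1 !mxE.
Qed.

(* Sylvester's law of inertia: if d2 had more negative entries than d1, some
   nonzero c supported on the negative entries of d2 would have c *m W vanishing
   on the negative entries of d1, so the form would be both < 0 and >= 0 at c. *)
Lemma inertia_leq (C : numClosedFieldType) n (W : 'M[C]_n) (d1 d2 : 'rV[C]_n) :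
  (forall j, d1 0 j \is Num.real) -> (forall j, d2 0 j \is Num.real) ->
  W *m diag_mx d1 *m (map_mx Num.conj W)^T = diag_mx d2 ->
  (#|[pred j | (d2 0 j < 0)%R]| <= #|[pred j | (d1 0 j < 0)%R]|)%N.
Proof.
move=> re1 re2 WE; rewrite leqNgt; apply/negP => ltTS.
set S : pred 'I_n := [pred j | (d2 0 j < 0)%R] in ltTS.
set T : pred 'I_n := [pred j | (d1 0 j < 0)%R] in ltTS.
(* Multiplication by [Sel] extends a vector indexed by [S] by zero to all indices. [A] keeps the
   columns of [Sel *m W] indexed by [T], so a vector of its left kernel yields the required [c]. *)
pose Sel : 'M[C]_(#|S|, n) := \matrix_(i, j) (enum_val i == j)%:R.
pose A : 'M[C]_(#|S|, #|T|) := \matrix_(i, j) (Sel *m W) i (enum_val j).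
have : kermx A != 0.
  rewrite -mxrank_eq0 mxrank_ker subn_eq0 -ltnNge.
  exact: leq_ltn_trans (rank_leq_col _) ltTS.
case/rowV0Pn => c0 /sub_kermxP c0A nz; case/negP: nz.
pose c := c0 *m Sel; pose w := c *m W.
have form (d x : 'rV[C]_n) :
    (x *m diag_mx d *m (map_mx Num.conj x)^T) 0 0 = \sum_j d 0 j * `|x 0 j| ^+ 2.
  rewrite mxE; apply: eq_bigr => j _; rewrite mul_mx_diag !mxE normCK.
  by rewrite mulrA; congr (_ * _); exact: mulrC.
have w0 t : t \in T -> w 0 t = 0.
  move=> tT; have /rowP/(_ (enum_rank_in tT t)) := c0A.
  rewrite [RHS]mxE mxE => <-; rewrite /w /c -mulmxA mxE; apply: eq_bigr => i _.
  by rewrite [A _ _]mxE enum_rankK_in.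
have cE i : c 0 (enum_val i) = c0 0 i.
  rewrite mxE (bigD1 i)//= mxE eqxx mulr1 big1 ?addr0// => j ji.
  by rewrite mxE (inj_eq enum_val_inj) (negPf ji) mulr0.
have cN j : j \notin S -> c 0 j = 0.
  move=> jS; rewrite mxE big1// => i _; rewrite mxE; case: eqP => [iE|_].
    by rewrite -iE enum_valP in jS.
  by rewrite mulr0.
have ce : \sum_j d2 0 j * `|c 0 j| ^+ 2 = \sum_j d1 0 j * `|w 0 j| ^+ 2.
  by rewrite -!form -WE [map_mx _ w]map_mxM trmx_mul !mulmxA.
have ge0 : 0 <= \sum_j d1 0 j * `|w 0 j| ^+ 2.
  apply: sumr_ge0 => j _; have [/w0 ->|] := boolP (j \in T).
    by rewrite normr0 expr0n mulr0.
  rewrite inE -real_leNgt ?real0// => d1j.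
  by rewrite mulr_ge0// exprn_ge0.
have le0 j : d2 0 j * `|c 0 j| ^+ 2 <= 0.
  have [|/cN ->] := boolP (j \in S); last by rewrite normr0 expr0n mulr0.
  by rewrite inE => /ltW d2j; rewrite mulr_le0_ge0// exprn_ge0.
(* The value of the form is squeezed to 0, so every term vanishes; as [d2] is strictly negative on
   [S], this forces [c0] to be 0. *)
have sum0 : \sum_j - (d2 0 j * `|c 0 j| ^+ 2) == 0.
  rewrite sumrN oppr_eq0 eq_le ce ge0 -ce andbT.
  by rewrite -oppr_ge0 -sumrN sumr_ge0// => j _; rewrite oppr_ge0.
have all0 j : d2 0 j * `|c 0 j| ^+ 2 = 0.
  move: sum0; rewrite psumr_eq0 => [|i _]; last by rewrite oppr_ge0.
  by move=> /allP/(_ j); rewrite mem_index_enum oppr_eq0 => /(_ isT)/eqP.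
apply/eqP/rowP => i; rewrite mxE -cE.
have : d2 0 (enum_val i) < 0 := enum_valP i.
move=> /ltr0_neq0/negPf d2i.
by have /eqP := all0 (enum_val i); rewrite mulf_eq0 d2i/= expf_eq0/= normr_eq0 => /eqP.
Qed.

(** Two boolean tuples of the same length with equally many true entries are rearrangements of each
    other, and [s] is the rearrangement. *)
Lemma eq_card_perm n (p q : pred 'I_n) : #|p| = #|q| ->
  exists s : 'S_n, forall j, p (s j) = q j.
Proof.
move=> pq.
(* A predicate on booleans is known from its two values, so each count depends on [r] only through
   its cardinality. *)
have cnt (r : pred 'I_n) (a : pred bool) :
    count a [tuple r j | j < n] =
    ((if a true then #|r| else 0) + (if a false then n - #|r| else 0))%N.
  have cr : count r (enum 'I_n) = #|r|.
    by rewrite -size_filter cardE /enum_mem -filter_predI; congr size;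
       apply: eq_filter => x; rewrite /= andbT.
  have cp : count (predC r) (enum 'I_n) = (n - #|r|)%N.
    have : (#|r| + count (predC r) (enum 'I_n) = n)%N.
      by rewrite -cr count_predC size_enum_ord.
    by move/(congr1 (subn^~ #|r|)); rewrite addKn.
  have le_rn : (#|r| <= n)%N by rewrite -[n in X in (_ <= X)%N]card_ord max_card.
  rewrite /= count_map; case aT : (a true); case aF : (a false).
  - rewrite subnKC// (@eq_count _ _ predT) ?count_predT ?size_enum_ord// => x /=.
    by case: (r x).
  - by rewrite addn0 (@eq_count _ _ r)// => x /=; case: (r x).
  - by rewrite (@eq_count _ _ (predC r))// => x /=; case: (r x).
  - by rewrite (@eq_count _ _ pred0) ?count_pred0// => x /=; case: (r x).
have /tuple_permP[s sE] : perm_eq [tuple q j | j < n] [tuple p j | j < n].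
  by apply/seq.permP => a; rewrite !cnt pq.
exists s => j; have /val_inj/(congr1 (fun t => tnth t j)) := sE.
by rewrite !tnth_mktuple => ->.
Qed.

Lemma mxCM (R : realType) m (A B : 'M[R]_m) : mxC (A *m B) = mxC A *m mxC B.
Proof. exact: (map_mxM (real_complex R)). Qed.

Lemma conj_mxC (R : realType) m (A : 'M[R]_m) : map_mx Num.conj (mxC A) = mxC A.
Proof. by apply/matrixP => i j; rewrite !mxE; exact: conjc_real. Qed.

Lemma det_mxC (R : realType) m (A : 'M[R]_m) : \det (mxC A) = (\det A)%:C.
Proof. exact: (det_map_mx (real_complex R)). Qed.

Lemma unit_mxC (R : realType) m (A : 'M[R]_m) : A \in unitmx -> mxC A \in unitmx.
Proof. by rewrite /mxC (map_unitmx (real_complex R)). Qed.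

Lemma tr_Ikm (R : realType) k m : (Ikm R k m)^T = Ikm R k m.
Proof. exact: tr_diag_mx. Qed.

Lemma IkmK (R : realType) k m : Ikm R k m *m Ikm R k m = 1%:M.
Proof.
rewrite /Ikm mulmx_diag -diag_const_mx; congr diag_mx; apply/rowP => j.
by rewrite !mxE /eps; case: ifP; rewrite ?mulrNN mulr1.
Qed.

Lemma det_Ikm_neq0 (R : realType) k m : \det (Ikm R k m) != 0.
Proof.
by have [] := mulmx1_unit (IkmK R k m); rewrite unitmxE unitfE.
Qed.

Lemma mxC_diag_real (R : realType) m (d : 'rV[R]_m) :
  mxC (diag_mx d) = diag_mx (map_mx (real_complex R) d).
Proof. exact: (map_diag_mx (real_complex R)). Qed.

(** A real congruence makes G diagonal; the complex matrix Z then relates this diagonal to I_{k,m}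
    by a Hermitian congruence, so both have equally many negative entries. A permutation and a
    rescaling, both real, finish the normalization. *)
Lemma lorentz_congr (R : realType) k m (Z : 'M[R[i]]_m) (G : 'M[R]_m) :
  \det Z != 0 -> G^T = G ->
  Z *m mxC (Ikm R k m) *m (map_mx Num.conj Z)^T = mxC G ->
  exists Q : 'M[R]_m, Q *m G *m Q^T = Ikm R k m.
Proof.
move=> detZ symG ZG; have [P [d [unitP PG]]] := sym_congr_diag symG.
pose W := mxC P *m Z.
have unitW : W \in unitmx.
  by rewrite unitmx_mul unit_mxC// unitmxE unitfE.
have WE : W *m mxC (Ikm R k m) *m (map_mx Num.conj W)^T = mxC (diag_mx d).
  have PT : (map_mx Num.conj (mxC P))^T = mxC P^T by rewrite conj_mxC /mxC map_trmx.
  by rewrite -PG mxCM (mxCM P) -ZG -PT /W map_mxM trmx_mul !mulmxA.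
clearbody W.
(* Without zero entries, a diagonal entry that is not negative is positive, and each can be divided
   by its absolute value. *)
have dn0 j : d 0 j != 0.
  have : \det (diag_mx d) != 0.
    suff: (\det (diag_mx d))%:C != 0 by apply: contraNneq => ->.
    have dW : \det W != 0 by rewrite -unitfE -unitmxE.
    rewrite -det_mxC -WE det_mulmx (det_mulmx W) det_tr (det_map_mx _ W).
    by rewrite !mulf_neq0 ?fmorph_eq0 ?det_mxC ?fmorph_eq0 ?det_Ikm_neq0.
  by rewrite det_diag => /prodf_neq0/(_ j); exact.
have realC (a : R) : a%:C \is Num.real by rewrite realE !lecR -realE num_real.
have negC (v : 'rV[R]_m) :
    [pred j | (map_mx (real_complex R) v) 0 j < 0] =i [pred j | v 0 j < 0].
  by move=> j; rewrite !inE mxE ltcR.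
have : #|[pred j | d 0 j < 0]| = #|[pred j : 'I_m | (\row_j eps R k j) 0 j < 0]|.
  rewrite -(eq_card (negC d)) -(eq_card (negC _)).
  have realv (v : 'rV[R]_m) j : map_mx (real_complex R) v 0 j \is Num.real.
    by rewrite mxE realC.
  (* One inequality comes from [W], the other from its inverse. *)
  apply/eqP; rewrite eqn_leq (@inertia_leq _ _ W)//; last by rewrite -!mxC_diag_real.
  rewrite (@inertia_leq _ _ (invmx W))// -!mxC_diag_real -WE !mulmxA mulVmx//.
  rewrite mul1mx -mulmxA -trmx_mul -map_mxM.
  by rewrite mulVmx// map_mx1 trmx1 mulmx1.
case/eq_card_perm => s sE.
(* The scaling acts on both sides of the form, so the inverse square root reduces each diagonal
   entry to its sign. *)
pose t := \row_j (Num.sqrt `|d 0 (s j)|)^-1.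
exists (diag_mx t *m row_perm s P); rewrite trmx_mul tr_diag_mx.
have -> : diag_mx t *m row_perm s P *m G *m ((row_perm s P)^T *m diag_mx t) =
    diag_mx t *m (row_perm s P *m G *m (row_perm s P)^T) *m diag_mx t.
  by rewrite !mulmxA.
have -> : row_perm s P *m G *m (row_perm s P)^T = diag_mx (\row_j d 0 (s j)).
  rewrite row_permE trmx_mul -!mulmxA [P *m _]mulmxA [P *m _ *m _]mulmxA PG.
  rewrite -row_permE tr_perm_mx -col_permE; apply/matrixP => i j.
  by rewrite !mxE (inj_eq perm_inj).
rewrite !mulmx_diag; congr diag_mx; apply/rowP => j; rewrite !mxE.
have sgd : d 0 (s j) = `|d 0 (s j)| * eps R k j.
  have := sE j; rewrite /= mxE /eps; case: ifP => _.
    by rewrite ltrN10 => d0; rewrite ltr0_norm// mulrN1 opprK.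
  by rewrite ltr10 => /negbT; rewrite -leNgt => d0; rewrite ger0_norm// mulr1.
rewrite mulrAC -invfM -expr2 sqr_sqrtr// {2}sgd mulrA mulVf ?mul1r//.
by rewrite normr_eq0.
Qed.

(** * Smooth maps *)

(** The difference g - f vanishes near x, so it is differentiable there with zero differential;
    adding f back gives g. *)
Lemma near_eq_differentiable {R : realFieldType} {V W : normedModType R}
    (f g : V -> W) (x : V) :
  (\forall y \near x, f y = g y) -> differentiable f x -> differentiable g x.
Proof.
move=> fg df; pose h := g - f.
suff dh : differentiable h x.
  by have := differentiableD dh df; rewrite /h subrK.
have hE : h \o shift x = cst (h x) + (\0 : {linear V -> W}) +o_ 0 id.
  apply/eqaddoP => _/posnumP[e].
  have h0 : \forall y \near 0, h (y + x) = 0.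
    have : \forall y \near x, h y = 0.
      near=> y; rewrite /h -[(g - f) y]/(g y - f y).
      by rewrite (_ : f y = g y) ?subrr//; near: y.
    by rewrite (near_shift 0 x) /=; apply: filterS => y; rewrite subr0.
  near=> y; rewrite -[X in `|X|]/(h (y + x) - (h x + 0)) (near h0 y)//.
  have -> : h x = 0 by have := nbhs_singleton h0; rewrite add0r.
  by rewrite addr0 subrr normr0 mulr_ge0.
apply/diff_locallyP; have cst0 : continuous (\0 : {linear V -> W}) by exact: cst_continuous.
by rewrite (diff_unique cst0 hE).
Unshelve. all: by end_near. Qed.

Section SmoothTheory.
Context {R : realType} {m : nat}.
Implicit Types (U : set 'rV[R]_m) (x : 'rV[R]_m).

(** Openness of U turns agreement on U into agreement near each of its points, so the partial
    derivatives agree on U as well and the induction on n proceeds. *)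
Lemma Cn_on_ext {V : normedModType R} n U (f g : 'rV[R]_m -> V) :
  open U -> (forall x, U x -> f x = g x) -> Cn_on n U f -> Cn_on n U g.
Proof.
move=> oU; elim: n f g => [|n IHn] f g fg /=.
  move=> cf x Ux; have nfg : {near x, f =1 g}.
    by near=> y; apply: fg; near: y; exact: open_nbhs_nbhs.
  change (g @ x --> g x); rewrite -fg//; apply: cvg_trans (cf x Ux).
  exact: (near_eq_cvg nfg).
case=> df pf; split=> [x Ux|i].
  have nfg : {near x, f =1 g}.
    by near=> y; apply: fg; near: y; exact: open_nbhs_nbhs.
  have := df x Ux; exact: near_eq_differentiable.
apply: IHn (pf i) => x Ux; apply: near_eq_derive.
by near=> y; apply: fg; near: y; exact: open_nbhs_nbhs.
Unshelve. all: by end_near. Qed.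

Lemma smooth_on_ext {V : normedModType R} U (f g : 'rV[R]_m -> V) :
  open U -> (forall x, U x -> f x = g x) -> smooth_on U f -> smooth_on U g.
Proof. by move=> oU fg sf n; exact: Cn_on_ext (sf n). Qed.

Lemma smooth_on_sub {V : normedModType R} U U' (f : 'rV[R]_m -> V) :
  U' `<=` U -> smooth_on U f -> smooth_on U' f.
Proof.
move=> sub sf n; elim: n f {sf} (sf n) => [|n IHn] f /= => [cf x /sub/cf//|[df pf]].
by split=> [x /sub/df//|i]; exact: IHn.
Qed.

Lemma smooth_on_differentiable {V : normedModType R} U (f : 'rV[R]_m -> V) x :
  smooth_on U f -> U x -> differentiable f x.
Proof. by move=> /(_ 1%N)[df _]; exact: df. Qed.

Lemma smooth_on_partial {V : normedModType R} U (f : 'rV[R]_m -> V) i :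
  smooth_on U f -> smooth_on U (partial i f).
Proof. by move=> sf n; have [_] := sf n.+1; exact. Qed.

Lemma smooth_on_cst {V : normedModType R} U (a : V) :
  smooth_on U (cst a : 'rV[R]_m -> V).
Proof.
move=> n; elim: n a => [|n IHn] a /=; first by move=> x _; exact: cst_continuous.
split=> [x _|i]; first exact: differentiable_cst.
have -> : partial i (cst a : 'rV[R]_m -> V) = cst 0.
  by apply/funext => x; rewrite /partial derive_cst.
exact: IHn.
Qed.

Lemma smooth_onD {V : normedModType R} U (f g : 'rV[R]_m -> V) :
  open U -> smooth_on U f -> smooth_on U g -> smooth_on U (f \+ g).
Proof.
move=> oU sf sg n; elim: n f g sf sg => [|n IHn] f g sf sg /=.
  by move=> x Ux; apply: continuousD; [exact: (sf 0%N)|exact: (sg 0%N)].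
have df x (Ux : U x) : differentiable f x := smooth_on_differentiable sf Ux.
have dg x (Ux : U x) : differentiable g x := smooth_on_differentiable sg Ux.
split=> [x Ux|i]; first exact: (differentiableD (df x Ux) (dg x Ux)).
(* The sum rule for derivatives is available only at points of [U], hence the passage through
   [Cn_on_ext]. *)
apply: (Cn_on_ext (f := partial i f \+ partial i g)) => // [x Ux|].
  rewrite /partial (deriveD (f := f) (g := g))//.
  - exact: diff_derivable (df x Ux).
  - exact: diff_derivable (dg x Ux).
by apply: IHn; exact: smooth_on_partial.
Qed.

Lemma smooth_on_sum {V : normedModType R} U n (f : 'I_n -> 'rV[R]_m -> V) :
  open U -> (forall j, smooth_on U (f j)) ->
  smooth_on U (fun x => \sum_j f j x).
Proof.
move=> oU; elim: n f => [|n IHn] f sf.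
  apply: (smooth_on_ext (f := cst 0)) => // [x _|]; first by rewrite big_ord0.
  exact: smooth_on_cst.
apply: (smooth_on_ext (f := (fun x => \sum_j f (widen_ord (leqnSn n) j) x) \+ f ord_max)) => //.
  by move=> x _; rewrite big_ord_recr.
by apply: smooth_onD => //; exact: IHn.
Qed.

Lemma smooth_on_id U : smooth_on U (fun x => x).
Proof.
move=> [|n] /=; first by move=> x _; exact: cvg_id.
split=> [x _|i].
  exact: (@ex_diff _ _ _ _ _ _ _ (is_diff_id x)).
have -> : partial i (fun x => x) = cst (delta_mx 0 i).
  by apply/funext => x; rewrite /partial derive_id.
exact: smooth_on_cst.
Qed.

Lemma smooth_onZl {V : normedModType R} U (g : 'rV[R]_m -> R) (w : V) :
  open U -> smooth_on U g -> smooth_on U (fun x => g x *: w).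
Proof.
move=> oU sg n; elim: n g sg => [|n IHn] g sg /=.
  move=> x Ux; apply: (@continuous_comp _ _ _ g ( *:%R ^~ w)).
    exact: (sg 0%N).
  exact: scalel_continuous.
have dg x (Ux : U x) : differentiable g x := smooth_on_differentiable sg Ux.
split=> [x Ux|i]; first exact: differentiableZl (dg x Ux).
apply: (Cn_on_ext (f := fun x => partial i g x *: w)) => // [x Ux|].
  rewrite /partial (deriveE _ (dg x Ux)).
  rewrite (deriveE _ (differentiableZl w (dg x Ux))).
  by rewrite (diffZl w (dg x Ux)).
by apply: IHn; exact: smooth_on_partial.
Qed.

Lemma smooth_on_pair {V W : normedModType R} U (f : 'rV[R]_m -> V)
    (g : 'rV[R]_m -> W) :
  open U -> smooth_on U f -> smooth_on U g -> smooth_on U (fun x => (f x, g x)).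
Proof.
move=> oU sf sg n; elim: n f g sf sg => [|n IHn] f g sf sg /=.
  by move=> x Ux; exact: cvg_pair (sf 0%N x Ux) (sg 0%N x Ux).
have df x (Ux : U x) : differentiable f x := smooth_on_differentiable sf Ux.
have dg x (Ux : U x) : differentiable g x := smooth_on_differentiable sg Ux.
split=> [x Ux|i]; first exact: differentiable_pair (df x Ux) (dg x Ux).
apply: (Cn_on_ext (f := fun x => (partial i f x, partial i g x))) => // [x Ux|].
  rewrite /partial (deriveE _ (dg x Ux)) (deriveE _ (df x Ux)).
  rewrite (deriveE _ (differentiable_pair (df x Ux) (dg x Ux))).
  by rewrite (diff_pair (df x Ux) (dg x Ux)).
by apply: IHn; exact: smooth_on_partial.
Qed.

Lemma derive_partial {V : normedModType R} (f : 'rV[R]_m -> V) x v :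
  differentiable f x -> 'd f x v = \sum_i v 0 i *: partial i f x.
Proof.
move=> df; rewrite {1}[v]row_sum_delta linear_sum; apply: eq_bigr => i _.
by rewrite linearZ /partial deriveE.
Qed.

End SmoothTheory.

(** * Symmetry of second derivatives *)

(** The chain rule along a line brings directional derivatives within reach of the one-variable mean
    value theorem; it also gives the velocity of lifted lines in [tangent_graph]. *)
Lemma is_derive_line {R : realType} {V W : normedModType R} (f : V -> W)
    (a v : V) (s : R) :
  differentiable f (a + s *: v) ->
  is_derive s (1 : R) (fun t : R => f (a + t *: v)) ('D_v f (a + s *: v)).
Proof.
move=> df.
have dl : is_diff s (fun t : R => a + t *: v) (fun t => t *: v).
  by apply: is_diff_eq; rewrite /cst/= add0r.
have dc := differentiable_comp (@ex_diff _ _ _ _ _ _ _ dl) df.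
apply: DeriveDef; first exact: diff_derivable dc.
rewrite (deriveE _ dc) (diff_comp (@ex_diff _ _ _ _ _ _ _ dl) df)/=.
by rewrite (@diff_val _ _ _ _ _ _ _ dl) scale1r deriveE.
Qed.

Lemma MVT_is_derive {R : realType} (f df : R -> R) (t : R) : 0 < t ->
  (forall s, 0 <= s <= t -> is_derive s (1 : R) f (df s)) ->
  exists2 s, 0 <= s <= t & f t - f 0 = df s * t.
Proof.
move=> t0 dfs; have itv s : s \in `[0, t] -> 0 <= s <= t by rewrite in_itv.
have [||s sI] := @MVT_segment _ f df _ _ (ltW t0).
- by move=> s sI; apply/dfs/itv; exact: subset_itv_oo_cc sI.
- by apply: derivable_within_continuous => s /itv/dfs[].
by rewrite subr0 => fE; exists s => //; exact: itv.
Qed.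

(** Two uses of the mean value theorem: first in direction v, for the increment of f under
    translation by t w, then in direction w, for the derivative of f along v. *)
Lemma second_difference {R : realType} {V : normedModType R} (U : set V)
    (f : V -> R) (x v w : V) (t : R) : 0 < t ->
  (forall y, U y -> differentiable f y) ->
  (forall y, U y -> differentiable ('D_v f) y) ->
  (forall s r, 0 <= s <= t -> 0 <= r <= t -> U (x + s *: v + r *: w)) ->
  exists s r, [/\ 0 <= s <= t, 0 <= r <= t &
    f (x + t *: v + t *: w) - f (x + t *: v) - (f (x + t *: w) - f x) =
    'D_w ('D_v f) (x + s *: v + r *: w) * t * t].
Proof.
move=> t0 df ddf inU.
have tt : 0 <= t <= t by rewrite lexx ltW.
have zt : 0 <= (0 : R) <= t by rewrite lexx ltW.
have dg (s : R) : 0 <= s <= t -> is_derive s (1 : R)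
    (fun s : R => f (x + t *: w + s *: v) - f (x + s *: v))
    ('D_v f (x + t *: w + s *: v) - 'D_v f (x + s *: v)).
  move=> st; apply: is_deriveB; apply: is_derive_line; apply: df.
    by rewrite addrAC; exact: inU.
  by have := inU s 0 st zt; rewrite scale0r addr0.
have [s st] := MVT_is_derive t0 dg; rewrite !scale0r !addr0 (addrAC x) => gE.
have dh (r : R) : 0 <= r <= t -> is_derive r (1 : R)
    (fun r : R => 'D_v f (x + s *: v + r *: w))
    ('D_w ('D_v f) (x + s *: v + r *: w)).
  by move=> rt; apply: is_derive_line; apply: ddf; apply: inU.
have [r rt] := MVT_is_derive t0 dh; rewrite scale0r addr0 => hE.
exists s, r; split=> //.
by rewrite gE -hE (addrAC x).
Qed.

(* Both second derivatives are limits of the same second difference quotient. *)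
Lemma derive_comm {R : realType} {V : normedModType R} (U : set V)
    (f : V -> R) (x v w : V) : open U -> U x ->
  (forall y, U y -> differentiable f y) ->
  (forall y, U y -> differentiable ('D_v f) y) ->
  (forall y, U y -> differentiable ('D_w f) y) ->
  {for x, continuous ('D_w ('D_v f))} -> {for x, continuous ('D_v ('D_w f))} ->
  'D_w ('D_v f) x = 'D_v ('D_w f) x.
Proof.
move=> oU Ux df dv dw cwv cvw.
set A := 'D_w _ x; set B := 'D_v _ x; apply/eqP/negPn/negP => AB.
have e0 : 0 < `|A - B| / 2 by rewrite divr_gt0// normr_gt0 subr_eq0.
move/cvgrPdist_lt : cwv => /(_ _ e0) nA; move/cvgrPdist_lt : cvw => /(_ _ e0) nB.
have nU : \forall y \near x, U y by exact: open_nbhs_nbhs.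
have [d /= d0 Hd] := (nbhs_normP _ _).1 (filterI nU (filterI nA nB)).
(* With this [t] the parallelogram spanned by t v and t w at x lies in the ball of radius [d]; the
   summand 1 keeps the denominator positive and the estimate strict. *)
pose t := d / (`|v| + `|w| + 1).
have k0 : 0 < `|v| + `|w| + 1 by rewrite ltr_wpDl// addr_ge0.
have t0 : 0 < t by rewrite divr_gt0.
have inball s r : 0 <= s <= t -> 0 <= r <= t ->
    ball_ Num.norm x d (x + s *: v + r *: w).
  move=> /andP[s0 st] /andP[r0 rt]; rewrite /ball_/= -addrA opprD addNKr normrN.
  apply: (@le_lt_trans _ _ (t * (`|v| + `|w|))).
    rewrite (le_trans (ler_normD _ _))// !normrZ !ger0_norm// mulrDr.
    by rewrite lerD// ler_wpM2r.
  by rewrite /t mulrAC ltr_pdivrMr// ltr_pM2l// ltrDl.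
have inball' s r : 0 <= s <= t -> 0 <= r <= t ->
    ball_ Num.norm x d (x + s *: w + r *: v).
  by move=> st rt; rewrite addrAC; exact: inball.
have inU s r : 0 <= s <= t -> 0 <= r <= t -> U (x + s *: v + r *: w).
  by move=> st rt; have [] := Hd _ (inball s r st rt).
have inU' s r : 0 <= s <= t -> 0 <= r <= t -> U (x + s *: w + r *: v).
  by move=> st rt; rewrite addrAC; exact: inU.
have [s [r [st rt E1]]] := second_difference t0 df dv inU.
have [s' [r' [st' rt' E2]]] := second_difference t0 df dw inU'.
have [_ [nA1 _]] := Hd _ (inball s r st rt).
have [_ [_ nB1]] := Hd _ (inball' s' r' st' rt').
have key (a b : R) : a = b ->
    `|A - a| < `|A - B| / 2 -> `|B - b| < `|A - B| / 2 -> False.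
  move=> <- lA; rewrite distrC => lB; have := le_lt_trans (ler_distD a A B) (ltrD lA lB).
  by rewrite -splitr ltxx.
apply: key nA1 nB1; apply: (mulIf (lt0r_neq0 t0)); apply: (mulIf (lt0r_neq0 t0)).
(* [E1] and [E2] evaluate the same second difference: exchanging [v] and [w] only permutes its four
   terms. *)
apply: etrans (esym E1) (etrans _ E2).
rewrite (addrAC x (t *: w)) !opprB addrACA [RHS]addrACA.
by congr (_ + _); exact: addrC.
Qed.

Lemma partial_comm {R : realType} {m : nat} (U : set 'rV[R]_m)
    (f : 'rV[R]_m -> R) i j x : open U -> smooth_on U f -> U x ->
  partial j (partial i f) x = partial i (partial j f) x.
Proof.
move=> oU sf Ux; rewrite /partial; apply: (derive_comm oU Ux).
- by move=> y; exact: smooth_on_differentiable sf.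
- by move=> y; exact: smooth_on_differentiable (smooth_on_partial i sf).
- by move=> y; exact: smooth_on_differentiable (smooth_on_partial j sf).
- exact: (smooth_on_partial j (smooth_on_partial i sf) 0%N).
- exact: (smooth_on_partial i (smooth_on_partial j sf) 0%N).
Qed.

(** * Graphs *)

Section Graph.
Context {R : realType} {m : nat}.
Implicit Types (Omega U : set 'rV[R]_m) (f : 'rV[R]_m -> 'rV[R]_m).

Lemma diff_graph f x v : differentiable f x ->
  'd (fun y => (y, f y)) x v = (v, 'd f x v).
Proof.
move=> df; have di : differentiable (fun y : 'rV[R]_m => y) x.
  exact: (@ex_diff _ _ _ _ _ _ _ (is_diff_id x)).
have idE : 'd (fun y : 'rV[R]_m => y) x = id :> ('rV[R]_m -> 'rV[R]_m).
  exact: (@diff_val _ _ _ _ _ _ _ (is_diff_id x)).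
rewrite (diff_pair di df).
by congr (_, _); exact: (congr1 (fun g : 'rV[R]_m -> 'rV[R]_m => g v) idE).
Qed.

(** Near 0 a curve in the graph is the lift of its first component, so the chain rule gives its
    velocity. Conversely, v is realized by lifting the line x + t v, which stays in the open set for
    small t. *)
Lemma tangent_graph Omega f x : open Omega -> Omega x -> differentiable f x ->
  tangent (graph_of Omega f) (x, f x) = range (fun v => (v, 'd f x v)).
Proof.
move=> oO Ox df; pose phi y := (y, f y).
have dphi : differentiable phi x.
  exact: differentiable_pair (@ex_diff _ _ _ _ _ _ _ (is_diff_id x)) df.
apply/seteqP; split=> [w|_ [v _ <-]] /=.
- case=> gamma [g0 gM [dg gw]]; pose a := fst \o gamma.
  have dfst p : differentiable (fst : Cspace R m -> 'rV[R]_m) p.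
    by apply: linear_differentiable => q; exact: cvg_fst.
  have dgam : differentiable gamma 0 by exact/derivable1_diffP.
  have da : differentiable a 0 by exact: differentiable_comp.
  have a0 : a 0 = x by rewrite /a /= g0.
  have dphi' : differentiable phi (a 0) by rewrite a0.
  have ga : \forall t \near (0 : R), (phi \o a) t = gamma t.
    by apply: filterS gM => t [y _ yE]; rewrite /phi /a /= -yE.
  exists ('D_1 a 0) => //; rewrite -gw -(near_eq_derive _ ga).
  have dpa : differentiable (phi \o a) 0 by exact: differentiable_comp.
  rewrite (deriveE _ dpa) (diff_comp da dphi') /= a0 diff_graph//.
  by rewrite (deriveE _ da).
- exists (fun t => phi (x + t *: v)); split.
  + by rewrite scale0r addr0.
  + have : \forall t \near (0 : R), Omega (x + t *: v).
      have /= c : {for (0 : R), continuous (fun t : R => x + t *: v)}.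
        apply: differentiable_continuous.
        have d : is_diff (0 : R) (fun t : R => x + t *: v) (fun t => t *: v).
          by apply: is_diff_eq; rewrite /cst/= add0r.
        exact: (@ex_diff _ _ _ _ _ _ _ d).
      apply: c; rewrite scale0r addr0; exact: open_nbhs_nbhs.
    by apply: filterS => t Ot; exists (x + t *: v).
  + have dphi' : differentiable phi (x + 0 *: v) by rewrite scale0r addr0.
    have := is_derive_line dphi'.
    by rewrite scale0r addr0 (deriveE _ dphi) diff_graph.
Qed.

(** The first projection is a continuous inverse of the parametrization. A smaller domain U is
    allowed because the charts that witness an orientation are cut down to sets where a determinant
    has constant sign. *)
Lemma local_param_graph Omega U f : open U -> U `<=` Omega -> smooth_on U f ->
  local_param (graph_of Omega f) U (fun x => (x, f x)).
Proof.
move=> oU UO sf; have df x (Ux : U x) : differentiable f x := smooth_on_differentiable sf Ux.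
split=> //.
- by apply: smooth_on_pair => //; exact: smooth_on_id.
- by move=> x Ux v w; rewrite !diff_graph; [case|exact: df..].
exists (fst @^-1` U), fst; split=> //.
- by apply: open_comp => // p _; exact: cvg_fst.
- apply/seteqP; split=> [_ [x Ux <-]|_ [[x Ox <-] Ux]].
    by split=> //; exists x => //; exact: UO.
  by exists x.
- by apply: continuous_subspaceT => p; exact: cvg_fst.
Qed.

Lemma submanifold_graph Omega f : open Omega -> smooth_on Omega f ->
  submanifold (graph_of Omega f).
Proof.
move=> oO sf _ [x Ox <-]; exists Omega, (fun x => (x, f x)); split.
  exact: local_param_graph.
by exists x.
Qed.

Lemma coord_frame_graph f x : differentiable f x ->
  coord_frame (fun y => (y, f y)) x =
  [tuple (delta_mx 0 j, 'd f x (delta_mx 0 j)) | j < m].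
Proof.
move=> df; apply: eq_from_tnth => j; rewrite !tnth_mktuple /partial.
rewrite deriveE ?diff_graph//; apply: differentiable_pair df.
exact: (@ex_diff _ _ _ _ _ _ _ (is_diff_id x)).
Qed.

End Graph.

Section Gradient.
Context {R : realType} {m k : nat} (u : 'rV[R]_m -> R) (Omega : set 'rV[R]_m).
Context (oO : open Omega) (su : smooth_on Omega u).
Let f x := grad u x *m Ikm R k m.

Lemma hess_sym x : Omega x -> (hess u x)^T = hess u x.
Proof.
by move=> Ox; apply/matrixP => i j; rewrite !mxE; exact: (partial_comm _ _ oO).
Qed.

Lemma smooth_on_grad : smooth_on Omega f.
Proof.
apply: (smooth_on_ext (f := fun x => \sum_j partial j u x *: (eps R k j *: delta_mx 0 j))) => //.
  move=> x _; rewrite /f mul_mx_diag [RHS]row_sum_delta; apply: eq_bigr => j _.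
  by rewrite !mxE scalerA.
by apply: smooth_on_sum => // j; apply: smooth_onZl => //; exact: smooth_on_partial.
Qed.

Lemma diff_grad x v : Omega x -> 'd f x v = v *m (hess u x *m Ikm R k m).
Proof.
move=> Ox; have df : differentiable f x.
  exact: smooth_on_differentiable smooth_on_grad Ox.
have dp j : differentiable (partial j u) x.
  exact: smooth_on_differentiable (smooth_on_partial j su) Ox.
rewrite -(deriveE _ df) derive_mx; last exact: diff_derivable.
apply/rowP => j; rewrite mxE mulmxA.
have -> : (fun t => f t 0 j) = (fun t => partial j u t *: eps R k j).
  by apply/funext => t; rewrite /f mul_mx_diag !mxE.
rewrite (deriveE _ (differentiableZl _ (dp j))) (diffZl _ (dp j)).
rewrite (derive_partial _ (dp j)) mul_mx_diag !mxE; congr (_ * _).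
(* Differentiating the j-th component produces the Hessian entry (j, i), whereas the row-vector
   product needs (i, j). *)
by apply: eq_bigr => i _; rewrite -[in RHS](hess_sym Ox) !mxE.
Qed.

End Gradient.

(** * Frames of a linear graph *)

(** A frame of the linear space of all (v, v B) is encoded by its projection to R^m, the rows of P:
    bases correspond to invertible P, and a change of basis to multiplication of P on the left. *)
Definition graph_frame {R : realType} {m : nat} (B P : 'M[R]_m) :
    m.-tuple (Cspace R m) :=
  [tuple (row l P, row l P *m B) | l < m].

(* Row l of zmx B lists the dz_j of the l-th vector of graph_frame B 1. *)
Definition zmx {R : realType} {m : nat} (B : 'M[R]_m) : 'M[R[i]]_m :=
  1%:M + 'i%C *: mxC B.

(** Matrix of the metric induced on the linear graph, in the coordinates given by projection to
    R^m. *)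
Definition gram {R : realType} {m : nat} (k : nat) (B : 'M[R]_m) : 'M[R]_m :=
  Ikm R k m + B *m Ikm R k m *m B^T.

Section LinearGraph.
Context {R : realType} {m : nat}.
Implicit Types (A B P : 'M[R]_m) (a b : 'rV[R]_m).

Lemma sum_fst n (F : 'I_n -> Cspace R m) : (\sum_i F i).1 = \sum_i (F i).1.
Proof. exact: (raddf_sum (fst : {additive Cspace R m -> 'rV[R]_m})). Qed.

Lemma sum_snd n (F : 'I_n -> Cspace R m) : (\sum_i F i).2 = \sum_i (F i).2.
Proof. exact: (raddf_sum (snd : {additive Cspace R m -> 'rV[R]_m})). Qed.

Lemma comb_graph_frame B P a :
  \sum_j a 0 j *: tnth (graph_frame B P) j = (a *m P, a *m P *m B).
Proof.
have aP : \sum_j a 0 j *: row j P = a *m P by rewrite mulmx_sum_row.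
rewrite [LHS]surjective_pairing sum_fst sum_snd; congr (_, _).
  by rewrite -aP; apply: eq_bigr => j _; rewrite tnth_mktuple.
rewrite -aP mulmx_suml; apply: eq_bigr => j _.
by rewrite tnth_mktuple /= scalemxAl.
Qed.

Lemma comb_graph_frame_nth B P (c : 'I_m -> R) :
  \sum_j c j *: (graph_frame B P)`_j =
  ((\row_j c j) *m P, (\row_j c j) *m P *m B).
Proof.
rewrite -comb_graph_frame; apply: eq_bigr => j _.
by rewrite mxE (tnth_nth 0).
Qed.

Lemma graph_frame_comb B P A l :
  tnth (graph_frame B (A *m P)) l = \sum_j A l j *: tnth (graph_frame B P) j.
Proof.
transitivity (\sum_j row l A 0 j *: tnth (graph_frame B P) j).
  by rewrite comb_graph_frame tnth_mktuple row_mul.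
by apply: eq_bigr => j _; rewrite mxE.
Qed.

Lemma graph_frame_basis (M : set (Cspace R m)) p B P :
  tangent M p = range (fun v => (v, v *m B)) ->
  P \in unitmx -> tangent_basis M p (graph_frame B P).
Proof.
move=> tM uP; split.
  apply/freeP => c; rewrite comb_graph_frame_nth => -[/(congr1 (mulmx^~ (invmx P))) + _].
  by rewrite mulmxK// mul0mx => /rowP c0 j; have := c0 j; rewrite !mxE.
rewrite tM; apply/seteqP; split=> [_ [v _ <-]|w] /=.
  rewrite (_ : (v, _) = \sum_j (v *m invmx P) 0 j *: tnth (graph_frame B P) j).
    by apply: memv_suml => j _; apply/memvZ/memv_span/mem_tnth.
  by rewrite comb_graph_frame mulmxKV.
move=> /(coord_span (X := graph_frame B P)) ->.
by rewrite comb_graph_frame_nth; eexists.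
Qed.

(** A linear relation between the first components persists after multiplication by B, hence is a
    relation between the vectors of e; freeness therefore makes P invertible. *)
Lemma tangent_basis_graph (M : set (Cspace R m)) p B e :
  tangent M p = range (fun v => (v, v *m B)) ->
  tangent_basis M p e -> exists2 P, P \in unitmx & e = graph_frame B P.
Proof.
move=> tM [fe]; rewrite tM => te; pose P := \matrix_l (tnth e l).1.
have eE : e = graph_frame B P.
  apply: eq_from_tnth => l; rewrite tnth_mktuple rowK.
  have : [set v | v \in <<e>>%VS] (tnth e l) by exact/memv_span/mem_tnth.
  by rewrite -te => -[v _ <-].
exists P => //; rewrite -row_free_unit -kermx_eq0; apply/rowV0P => c /sub_kermxP cP.
have c0 : \sum_j c 0 j *: e`_j = 0.
  rewrite eE comb_graph_frame_nth (_ : \row_j c 0 j = c) ?cP ?mul0mx//.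
  by apply/rowP => j; rewrite mxE.
by move/freeP: fe => /(_ (c 0) c0) ce; apply/rowP => j; rewrite mxE ce.
Qed.

Lemma metric_graph k B a b :
  metric k (a, a *m B) (b, b *m B) = (a *m gram k B *m b^T) 0 0.
Proof.
have -> : a *m gram k B *m b^T =
    a *m Ikm R k m *m b^T + (a *m B) *m Ikm R k m *m (b *m B)^T.
  by rewrite /gram mulmxDr mulmxDl trmx_mul !mulmxA.
rewrite /metric !mxE -big_split; apply: eq_bigr => j _ /=.
by rewrite !mul_mx_diag !mxE mulrDr; congr (_ + _); rewrite mulrA [in RHS](mulrC _ (eps _ _ _)).
Qed.

(** With E = I_{k,m}, the form is a E (b B)^T - a B E b^T, and the hypothesis, which says that B E
    is symmetric, makes the two terms equal. *)
Lemma omega_graph k B a b : B *m Ikm R k m = Ikm R k m *m B^T ->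
  omega k (a, a *m B) (b, b *m B) = 0.
Proof.
move=> BE; have : a *m Ikm R k m *m (b *m B)^T = (a *m B) *m Ikm R k m *m b^T.
  by rewrite trmx_mul -[a *m B *m _]mulmxA BE !mulmxA.
move=> /matrixP/(_ 0 0)/eqP; rewrite -subr_eq0 => /eqP <-.
rewrite /omega !mxE -sumrB; apply: eq_bigr => j _ /=.
rewrite !mul_mx_diag !mxE mulrBr; congr (_ - _); first by rewrite mulrCA mulrA.
by rewrite [b 0 j * _]mulrC mulrA [eps _ _ _ * _]mulrC.
Qed.

(** The matrix of the values of the dz_j on the frame factors as P times [zmx B]. *)
Lemma dz_wedge_graph B P : dz_wedge (graph_frame B P) = (\det P)%:C * \det (zmx B).
Proof.
rewrite -det_mxC -det_mulmx; congr (\det _); rewrite /zmx mulmxDr mulmx1 -scalemxAr -mxCM.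
apply/matrixP => l j; rewrite [LHS]mxE tnth_mktuple /dz /= -row_mul.
have -> : (mxC P + 'i%C *: mxC (P *m B)) l j = (P l j)%:C + 'i%C * ((P *m B) l j)%:C.
  by rewrite !mxE.
by rewrite [row l P 0 j]mxE [row l (P *m B) 0 j]mxE [LHS]complexE.
Qed.

(* Hermitian form of the graph: its imaginary part is omega, which vanishes. *)
Lemma gram_zmx k B : B *m Ikm R k m = Ikm R k m *m B^T ->
  zmx B *m mxC (Ikm R k m) *m (map_mx Num.conj (zmx B))^T = mxC (gram k B).
Proof.
move=> BE.
have -> : (map_mx Num.conj (zmx B))^T = 1%:M - 'i%C *: mxC B^T.
  have conjr (r : R) : Num.conj r%:C = r%:C by exact: conjc_real.
  have conji : Num.conj 'i%C = - 'i%C :> R[i].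
    by apply/eqP; rewrite eq_complex/= oppr0 !eqxx.
  apply/matrixP => i j; rewrite !mxE rmorphD rmorphM eq_sym -mulNr.
  by congr (_ + _ * _); [exact: rmorph_nat|exact: conji|exact: conjr].
(* In the expanded product the cross terms i B E and - i E B^T cancel by [BE]. *)
rewrite /zmx mulmxDl mul1mx -scalemxAl -mxCM BE mulmxDl !mulmxBr !mulmx1.
rewrite -!scalemxAr -!scalemxAl -!mxCM scalerA.
have -> : 'i%C * 'i%C = -1 :> R[i] by rewrite -expr2 sqr_i.
rewrite scaleN1r opprK addrA subrK -BE.
by apply/matrixP => i j; rewrite !mxE rmorphD.
Qed.

Lemma tr_gram k B : (gram k B)^T = gram k B.
Proof. by rewrite /gram linearD/= !trmx_mul trmxK tr_Ikm mulmxA. Qed.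

Lemma det_gram_neq0 k B : B *m Ikm R k m = Ikm R k m *m B^T ->
  \det (zmx B) != 0 -> \det (gram k B) != 0.
Proof.
move=> BE dz; suff: (\det (gram k B))%:C != 0 by apply: contraNneq => ->.
rewrite -det_mxC -gram_zmx// !det_mulmx det_tr det_mxC (det_map_mx _ (zmx B)).
by rewrite !mulf_neq0 ?fmorph_eq0// det_Ikm_neq0.
Qed.

End LinearGraph.

(** * Special Lagrangian graphs *)

Section ContinuousDet.
Context {R : realType} {T : topologicalType}.
Implicit Types (g h : T -> R[i]) (x : T).

(** Continuity is split into real and imaginary parts so that only the rules for real-valued
    functions are called upon. *)
Definition continuousC_at x g :=
  {for x, continuous (fun y => complex.Re (g y))} /\
  {for x, continuous (fun y => complex.Im (g y))}.

Lemma continuousC_cst x (c : R[i]) : continuousC_at x (fun=> c).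
Proof. by split; exact: cst_continuous. Qed.

Lemma continuousC_add x g h : continuousC_at x g -> continuousC_at x h ->
  continuousC_at x (fun y => g y + h y).
Proof.
move=> [rg ig] [rh ih]; split.
- rewrite (_ : (fun y => _) = (fun y => complex.Re (g y) + complex.Re (h y))).
    exact: continuousD.
  by apply/funext => y; case: (g y) (h y) => ? ? [].
- rewrite (_ : (fun y => _) = (fun y => complex.Im (g y) + complex.Im (h y))).
    exact: continuousD.
  by apply/funext => y; case: (g y) (h y) => ? ? [].
Qed.

Lemma continuousC_mul x g h : continuousC_at x g -> continuousC_at x h ->
  continuousC_at x (fun y => g y * h y).
Proof.
move=> [rg ig] [rh ih]; split.
- rewrite (_ : (fun y => _) = (fun y => complex.Re (g y) * complex.Re (h y) -
      complex.Im (g y) * complex.Im (h y))).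
    by apply: continuousB; apply: continuousM.
  by apply/funext => y; case: (g y) (h y) => ? ? [].
- rewrite (_ : (fun y => _) = (fun y => complex.Re (g y) * complex.Im (h y) +
      complex.Im (g y) * complex.Re (h y))).
    by apply: continuousD; apply: continuousM.
  by apply/funext => y; case: (g y) (h y) => ? ? [].
Qed.

(** Leibniz expansion: continuity passes through the sum over permutations and through each product,
    by induction on the two index lists. *)
Lemma continuousC_det n (Z : T -> 'M[R[i]]_n) x :
  (forall i j, continuousC_at x (fun y => Z y i j)) ->
  continuousC_at x (fun y => \det (Z y)).
Proof.
move=> cZ; rewrite /determinant.
elim: (index_enum _) => [|s r IHr].
  under eq_fun do rewrite big_nil; exact: continuousC_cst.
under eq_fun do rewrite big_cons; apply: continuousC_add IHr.
apply: continuousC_mul; first exact: continuousC_cst.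
elim: (index_enum _) => [|i q IHq].
  under eq_fun do rewrite big_nil; exact: continuousC_cst.
by under eq_fun do rewrite big_cons; exact: continuousC_mul.
Qed.

Lemma continuous_Re_det n (B : T -> 'M[R]_n) x :
  (forall i j, {for x, continuous (fun y => B y i j)}) ->
  {for x, continuous (fun y => complex.Re (\det (zmx (B y))))}.
Proof.
move=> cB; suff [] : continuousC_at x (fun y => \det (zmx (B y))) by [].
apply: continuousC_det => i j.
under eq_fun do rewrite /zmx !mxE.
apply: continuousC_add; first exact: continuousC_cst.
apply: continuousC_mul; first exact: continuousC_cst.
by split; [exact: cB|exact: cst_continuous].
Qed.

End ContinuousDet.

Section LorentzFrames.
Context {R : realType} {m k : nat} (B : 'M[R]_m).

Lemma metric_graph_frame P j l :
  metric k (tnth (graph_frame B P) j) (tnth (graph_frame B P) l) =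
  (P *m gram k B *m P^T) j l.
Proof.
rewrite !tnth_mktuple metric_graph tr_row -row_mul !mxE.
by apply: eq_bigr => i _; rewrite !mxE.
Qed.

Lemma lorentz_graph_frame (M : set (Cspace R m)) p P :
  lorentz_basis k M p (graph_frame B P) -> P *m gram k B *m P^T = Ikm R k m.
Proof.
case=> _ eP; apply/matrixP => j l; rewrite -metric_graph_frame eP.
by rewrite !mxE; case: eqP => // ->.
Qed.

Lemma graph_frame_lorentz (M : set (Cspace R m)) p P :
  tangent M p = range (fun v => (v, v *m B)) ->
  P *m gram k B *m P^T = Ikm R k m -> lorentz_basis k M p (graph_frame B P).
Proof.
move=> tM PG; split.
  apply: graph_frame_basis tM _; rewrite unitmxE unitfE.
  apply: contraTneq (det_Ikm_neq0 R k m) => dP.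
  by rewrite -PG !det_mulmx dP !mul0r eqxx.
move=> j l; rewrite metric_graph_frame PG !mxE.
by case: eqP => // ->.
Qed.

Context (BE : B *m Ikm R k m = Ikm R k m *m B^T).

Lemma exists_lorentz_frame : \det (zmx B) != 0 ->
  exists P : 'M[R]_m, P *m gram k B *m P^T = Ikm R k m.
Proof. by move=> dz; exact: lorentz_congr dz (tr_gram k B) (gram_zmx BE). Qed.

(** When det Z is a real number r, the Gram matrix has determinant r^2 det E; taking determinants in
    P G P^T = E and cancelling det E gives the identity. *)
Lemma sqr_det_lorentz P : complex.Im (\det (zmx B)) = 0 ->
  P *m gram k B *m P^T = Ikm R k m ->
  (\det P * complex.Re (\det (zmx B))) ^+ 2 = 1.
Proof.
move=> im0 PG; set r := complex.Re _.
have zr : \det (zmx B) = r%:C by apply/eqP; rewrite eq_complex im0 !eqxx.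
have gr : \det (gram k B) = r ^+ 2 * \det (Ikm R k m).
  apply: (@complexI R); rewrite -det_mxC -gram_zmx// !det_mulmx det_tr det_mxC.
  have -> : \det (map_mx Num.conj (zmx B)) = r%:C.
    by rewrite det_map_mx zr; exact: conjc_real.
  rewrite zr.
  by rewrite rmorphM rmorphXn mulrAC expr2.
have := congr1 determinant PG; rewrite !det_mulmx det_tr gr => E.
apply: (mulIf (det_Ikm_neq0 R k m)); rewrite mul1r -[RHS]E [RHS]mulrAC mulrA.
by rewrite exprMn (expr2 (\det P)).
Qed.

End LorentzFrames.

(** Changing the sign of one vector keeps a basis Lorentz and reverses its orientation. *)
Lemma reflection_Ikm (R : realType) k m (i : 'I_m) :
  exists D : 'M[R]_m, D *m Ikm R k m *m D^T = Ikm R k m /\ \det D = -1.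
Proof.
exists (diag_mx (\row_j (-1) ^+ (j == i))); split.
  rewrite tr_diag_mx !mulmx_diag; congr diag_mx; apply/rowP => j; rewrite !mxE.
  by rewrite mulrAC -expr2 sqrr_sign mul1r.
rewrite det_diag (bigD1 i)//= mxE eqxx big1 ?mulr1 // => j /negPf ji.
by rewrite mxE ji.
Qed.

(** Non-degeneracy comes from invertibility of the Gram matrix G: testing (a, a B) against the
    vectors over the standard basis of R^m reads off the entries of a G. *)
Lemma lagrangian_graph {R : realType} {m k : nat} (Omega : set 'rV[R]_m)
    (f : 'rV[R]_m -> 'rV[R]_m) (B : 'rV[R]_m -> 'M[R]_m) :
  open Omega -> smooth_on Omega f ->
  (forall x, Omega x -> tangent (graph_of Omega f) (x, f x) =
                        range (fun v => (v, v *m B x))) ->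
  (forall x, Omega x -> B x *m Ikm R k m = Ikm R k m *m (B x)^T) ->
  (forall x, Omega x -> \det (zmx (B x)) != 0) ->
  lagrangian k (graph_of Omega f).
Proof.
move=> oO sf tf BE dz; split.
- exact: submanifold_graph.
- move=> _ [x Ox <-] v w; rewrite tf// => -[a _ <-] [b _ <-].
  exact/omega_graph/BE.
- move=> _ [x Ox <-] v; rewrite tf// => -[a _ <-] va0.
  have uG : gram k (B x) \in unitmx.
    by rewrite unitmxE unitfE det_gram_neq0//; [exact: BE|exact: dz].
  suff a0 : a *m gram k (B x) = 0.
    by rewrite -[a](mulmxK uG) a0 !mul0mx.
  apply/rowP => j; rewrite [RHS]mxE.
  have := va0 (delta_mx 0 j, delta_mx 0 j *m B x).
  rewrite metric_graph trmx_delta -colE mxE; apply.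
  by exists (delta_mx 0 j).
Qed.

Lemma Im_realM (R : realType) (a : R) (z : R[i]) :
  complex.Im (a%:C * z) = a * complex.Im z.
Proof. by case: z => x y /=; rewrite mul0r addr0. Qed.

Lemma Re_realM (R : realType) (a : R) (z : R[i]) :
  complex.Re (a%:C * z) = a * complex.Re z.
Proof. by case: z => x y /=; rewrite mul0r subr0. Qed.

(** Some Lorentz basis exists, and it or its reflection is positive. On a positive one det P det Z =
    1 with det P real, so det Z is real. *)
Lemma special_lagrangian_Im0 {R : realType} {m k : nat} (M : set (Cspace R m)) O p
    (B : 'M[R]_m) :
  special_lagrangian k M O -> M p ->
  tangent M p = range (fun v => (v, v *m B)) ->
  B *m Ikm R k m = Ikm R k m *m B^T -> \det (zmx B) != 0 ->
  complex.Im (\det (zmx B)) = 0.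
Proof.
move=> [_ [oriO _] sO] Mp tM BE dz.
have Im0 P : P *m gram k B *m P^T = Ikm R k m -> O p (graph_frame B P) ->
    complex.Im (\det (zmx B)) = 0.
  move=> PG OP; have := sO _ _ Mp (graph_frame_lorentz tM PG) OP.
  rewrite dz_wedge_graph => dP.
  have /eqP := congr1 (@complex.Im R) dP; rewrite Im_realM mulf_eq0.
  have /negPf -> : \det P != 0.
    by apply: contra_eq_neq dP => ->; rewrite mul0r eq_sym oner_eq0.
  by move=> /eqP.
have [P PG] := exists_lorentz_frame BE dz.
have [OP|nOP] := boolP (O p (graph_frame B P)); first exact: Im0 OP.
(* In dimension 0 there is no vector to reflect, but the empty determinant is 1, which is real. *)
case: (pickP 'I_m) => [i _|m0]; last first.
  have m0' : m = 0%N.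
    by apply/eqP; rewrite -leqn0 leqNgt; apply/negP => lt0m; have := m0 (Ordinal lt0m).
  by move: (zmx B); rewrite m0' => Z; rewrite det_mx00.
have [D [DE dD]] := reflection_Ikm R k i.
have DPG : (D *m P) *m gram k B *m (D *m P)^T = Ikm R k m.
  by rewrite trmx_mul !mulmxA -(mulmxA D) -(mulmxA D) PG.
apply: (Im0 _ DPG).
rewrite (oriO p (graph_frame B P) _ D Mp (graph_frame_lorentz tM PG).1
  (graph_frame_lorentz tM DPG).1 (graph_frame_comb _ _ _)).
by rewrite dD (negPf nOP) oppr_gt0 ltr10.
Qed.

Lemma sgr_mul_eq (R : realDomainType) (a b : R) : a != 0 -> b != 0 ->
  (0 < a * b) = ((0 < a) == (0 < b)).
Proof.
move=> a0 b0; case: (ltrgt0P a) a0 => // [a0|a0] _.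
  by rewrite pmulr_rgt0//.
by rewrite nmulr_rgt0//; case: (ltrgt0P b) b0.
Qed.

(** A continuous function without zeros keeps its sign near each point; the resulting open sets
    serve as chart domains on which the orientation is constant. *)
Lemma open_sign {R : realType} {T : topologicalType} (U : set T) (g : T -> R) b :
  open U -> (forall x, U x -> {for x, continuous g}) ->
  (forall x, U x -> g x != 0) -> open [set x | U x /\ (0 < g x) = b].
Proof.
move=> oU cg g0; rewrite openE => x /= [Ux gx].
have nU : \forall y \near x, U y by exact: open_nbhs_nbhs.
have : \forall y \near x, (0 < g y) = b.
  case: b gx => gx.
    by apply: filterS (cvgr_gt _ (cg x Ux) _ gx) => y.
  have gx0 : g x < 0 by rewrite lt_neqAle g0//= leNgt gx.
  by apply: filterS (cvgr_lt _ (cg x Ux) _ gx0) => y gy; rewrite ltNge ltW.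
by move=> nb; apply: filterS (filterI nU nb).
Qed.

(** On tangent bases dz_1 /\ ... /\ dz_m is real and nonzero, equal to det P times r = det Z. Its
    sign thus changes with the sign of the transition determinant, and defines the orientation. *)
Lemma special_lagrangian_graph {R : realType} {m k : nat} (Omega : set 'rV[R]_m)
    (f : 'rV[R]_m -> 'rV[R]_m) (B : 'rV[R]_m -> 'M[R]_m) :
  open Omega -> smooth_on Omega f ->
  (forall x v, Omega x -> 'd f x v = v *m B x) ->
  (forall i j x, Omega x -> {for x, continuous (fun y => B y i j)}) ->
  (forall x, Omega x -> tangent (graph_of Omega f) (x, f x) =
                        range (fun v => (v, v *m B x))) ->
  (forall x, Omega x -> B x *m Ikm R k m = Ikm R k m *m (B x)^T) ->
  (forall x, Omega x -> \det (zmx (B x)) != 0) ->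
  (forall x, Omega x -> complex.Im (\det (zmx (B x))) = 0) ->
  special_lagrangian k (graph_of Omega f)
    (fun _ e => 0 < complex.Re (dz_wedge e)).
Proof.
move=> oO sf df cB tf BE dz im0.
pose r x := complex.Re (\det (zmx (B x))).
have r0 x : Omega x -> r x != 0.
  move=> Ox; apply: contraNneq (dz x Ox) => rx.
  by rewrite eq_complex; apply/andP; split; apply/eqP => //=; exact: im0.
have wE x P : complex.Re (dz_wedge (graph_frame (B x) P)) = \det P * r x.
  by rewrite dz_wedge_graph Re_realM.
split; first exact: (lagrangian_graph oO sf tf BE dz).
- split=> [_ e e' A [x Ox <-]|_ [x Ox <-]].
    case/(tangent_basis_graph (tf x Ox)) => P uP ->.
    case/(tangent_basis_graph (tf x Ox)) => P' uP' -> AE.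
    have PE : P' = A *m P.
      apply/row_matrixP => l; have := AE l.
      by rewrite -graph_frame_comb !tnth_mktuple => -[].
    have dP : \det P != 0 by rewrite -unitfE -unitmxE.
    have dA : \det A != 0.
      move: uP'; rewrite PE unitmx_mul => /andP[+ _].
      by rewrite unitmxE unitfE.
    rewrite !wE PE det_mulmx -mulrA sgr_mul_eq//.
    by rewrite mulf_neq0// r0.
  pose b := 0 < r x.
  (* The chart is restricted to the points where [r] has the same sign as at [x]; its coordinate
     frame has P = I, so the orientation is decided by [r] alone. *)
  exists [set y | Omega y /\ (0 < r y) = b], (fun y => (y, f y)), b.
  have UO : [set y | Omega y /\ (0 < r y) = b] `<=` Omega by move=> y [].
  split; [|by exists x|].
    apply: local_param_graph => //; last exact: smooth_on_sub sf.
    apply: open_sign => // y Oy; apply: continuous_Re_det => i j; exact: cB.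
  move=> y [Oy <-]; rewrite coord_frame_graph; last exact: smooth_on_differentiable sf Oy.
  rewrite (_ : [tuple _ | j < m] = graph_frame (B y) 1%:M) ?wE ?det1 ?mul1r//.
  by apply: eq_from_tnth => j; rewrite !tnth_mktuple row1 df.
- move=> _ e [x Ox <-] Le.
  have [P uP eP] := tangent_basis_graph (tf x Ox) Le.1.
  move: Le; rewrite eP => /lorentz_graph_frame PG; rewrite wE => pos.
  have /eqP := sqr_det_lorentz (BE x Ox) (im0 x Ox) PG.
  (* The value on a Lorentz basis squares to 1, and on a positive one it is positive, hence it is
     1. *)
  rewrite sqrp_eq1 ?ltW// => /eqP w1; apply/eqP; rewrite eq_complex wE w1 eqxx/=.
  by rewrite dz_wedge_graph Im_realM im0// mulr0.
Qed.

Theorem theorem3p2 (R : realType) (m k : nat) (hk : (k <= m)%N)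
    (Omega : set 'rV[R]_m) (u : 'rV[R]_m -> R)
    (hOmega : open Omega) (hu : smooth_on Omega u)
    (hdet : forall x, Omega x ->
       \det (1%:M + 'i%C *: mxC (hess u x *m Ikm R k m)) != 0) :
  ((exists O, special_lagrangian k
        (graph_of Omega (fun x => grad u x *m Ikm R k m)) O)
   <-> (forall x, Omega x ->
          complex.Im (\det (1%:M + 'i%C *: mxC (hess u x *m Ikm R k m))) = 0))
  /\
  ((exists O, special_lagrangian k
        (graph_of Omega (fun x => grad u x *m Ikm R k m)) O)
   <-> (forall x, Omega x ->
          complex.Im (\det (mxC (Ikm R k m) + 'i%C *: mxC (hess u x))) = 0)).
Proof.
set f := fun x => grad u x *m Ikm R k m.
pose B x := hess u x *m Ikm R k m.
have sf : smooth_on Omega f by exact: smooth_on_grad.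
have df x v : Omega x -> 'd f x v = v *m B x by exact: diff_grad.
have tf x : Omega x ->
    tangent (graph_of Omega f) (x, f x) = range (fun v => (v, v *m B x)).
  move=> Ox; rewrite tangent_graph//; last exact: smooth_on_differentiable sf Ox.
  by congr image; apply/funext => v; rewrite df.
(* Both sides equal Hess(u), because I_{k,m} is an involution and Hess(u) is symmetric. *)
have BE x : Omega x -> B x *m Ikm R k m = Ikm R k m *m (B x)^T.
  move=> Ox; rewrite /B trmx_mul tr_Ikm (hess_sym hOmega)// mulmxA IkmK mul1mx.
  by rewrite -mulmxA IkmK mulmx1.
have cB i j x : Omega x -> {for x, continuous (fun y => B y i j)}.
  move=> Ox.
  rewrite (_ : (fun y => _) = (fun y => partial j (partial i u) y * eps R k j)).
    apply: (@continuousM _ _ (partial j (partial i u)) (cst (eps R k j)) x).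
      exact: (smooth_on_partial j (smooth_on_partial i hu) 0%N).
    exact: cst_continuous.
  by apply/funext => y; rewrite /B mul_mx_diag !mxE.
have I1 : (exists O, special_lagrangian k (graph_of Omega f) O) <->
    (forall x, Omega x -> complex.Im (\det (zmx (B x))) = 0).
  split=> [|im0].
    case=> O sO x Ox; apply: (special_lagrangian_Im0 sO _ (tf x Ox) (BE x Ox) (hdet x Ox)).
    by exists x.
  eexists; exact: (special_lagrangian_graph hOmega sf df cB tf BE hdet im0).
split; [exact: I1|apply: (iff_trans I1)].
(* The matrix I_{k,m} + i Hess(u) is Z I_{k,m}, so the two determinants differ by the nonzero real
   factor det I_{k,m} and their imaginary parts vanish together. *)
have dE x : \det (mxC (Ikm R k m) + 'i%C *: mxC (hess u x)) =
    (\det (Ikm R k m))%:C * \det (zmx (B x)).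
  rewrite mulrC -det_mxC -det_mulmx mulmxDl mul1mx -scalemxAl -mxCM.
  by rewrite /B -mulmxA IkmK mulmx1.
split=> im0 x Ox; have := im0 x Ox; rewrite dE Im_realM.
  by move=> ->; rewrite mulr0.
by move=> /eqP; rewrite mulf_eq0 (negPf (det_Ikm_neq0 R k m)) => /eqP.
Qed.
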